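(* For any integer $n \geq 3$, $$|\mathcal{F}(n; 231)| = |\mathcal{F}(n-1; 231)| + \sum_{k=2}^{n-1}|\mathcal{F}(k-1; 231)|\,|\mathcal{F}(n-k; 231)|,$$ with initial values $|\mathcal{F}(1; 231)| = 1$ and $|\mathcal{F}(2; 231)| = 1$.
   Context: For a positive integer $n$, $[n]=\{1,\dots,n\}$, and a permutation $\sigma$ of $[n]$ is written as the word $\sigma(1)\sigma(2)\cdots\sigma(n)$. A run of $\sigma$ is a maximal block of consecutive positions on which $\sigma$ is increasing, so $\sigma$ is uniquely the concatenation of its runs; the starting point of a run is its first entry. A flattened partition over $[n]$ is a permutation of $[n]$ whose runs, read from left to right, have increasing starting points. A permutation contains a pattern $\tau$ if it has a (not necessarily contiguous) subsequence order-isomorphic to $\tau$; otherwise it is $\tau$-avoiding. $\mathcal{F}(n;\tau)$ is the set of $\tau$-avoiding flattened partitions over $[n]$. *)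

(* Defs.v *)
From mathcomp Require Import all_boot all_fingroup.

Set Implicit Arguments.
Unset Strict Implicit.
Unset Printing Implicit Defensive.

(* A permutation of [n] = {1, ..., n} is an element of 'S_n; positions and
   values are both shifted down by 1, so that they range over 'I_n. *)

Definition word n (s : 'S_n) : seq nat := [seq (s i).+1 | i <- enum 'I_n].

Definition increasing_on n (s : 'S_n) (i j : 'I_n) : bool :=
  [forall x : 'I_n, forall y : 'I_n,
     [&& i <= x, x < y & y <= j] ==> (s x < s y)].

(* The block of consecutive positions i, ..., j is a run of s: it is nonempty,
   s increases on it, and it is inclusion-maximal among such blocks. *)
Definition is_run n (s : 'S_n) (i j : 'I_n) : bool :=
  [&& i <= j, increasing_on s i j
    & [forall i' : 'I_n, forall j' : 'I_n,
         [&& i' <= i, j <= j' & increasing_on s i' j'] ==>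
         (i' == i) && (j' == j)]].

(* Runs are disjoint, so "left to right" is the order of their first positions;
   the starting point of the run i, ..., j is the entry s i. *)
Definition flattened n (s : 'S_n) : bool :=
  [forall i1 : 'I_n, forall j1 : 'I_n, forall i2 : 'I_n, forall j2 : 'I_n,
     [&& is_run s i1 j1, is_run s i2 j2 & i1 < i2] ==> (s i1 < s i2)].

(* f selects the positions of a subsequence of s order-isomorphic to t. *)
Definition contains n k (s : 'S_n) (t : 'S_k) : bool :=
  [exists f : {ffun 'I_k -> 'I_n},
     [forall a : 'I_k, forall b : 'I_k, (a < b) ==> (f a < f b)] &&
     [forall a : 'I_k, forall b : 'I_k,
        (s (f a) < s (f b)) == (t a < t b)]].

Definition avoids n k (s : 'S_n) (t : 'S_k) : bool := ~~ contains s t.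

Definition flattened_avoiding n k (t : 'S_k) : {set 'S_n} :=
  [set s : 'S_n | flattened s && avoids s t].

Notation "''F' ( n ; t )" := (flattened_avoiding n t)
  (at level 8, n at level 99, t at level 99, format "''F' ( n ;  t )").

(* ordS is the cyclic successor on 'I_3; see word_p231. *)
Definition p231 : 'S_3 := perm (@ordS_inj 3).

Lemma word_p231 : word p231 = [:: 2; 3; 1].
Proof.
rewrite /word !enum_ordSl (size0nil (size_enum_ord 0)) /=.
by rewrite !permE.
Qed.

(* Main.v *)
Require Import Defs.
From mathcomp Require Import all_boot all_fingroup.
From mathcomp Require Import zify.

(** The decomposition around the largest entry.  Write the word of a flattened
    231-avoiding permutation of [n + 1] as L M R with M = n + 1 (lemma
    [mem_fwordsS]).

    - Avoiding 231 means exactly that L and R avoid it and that no entry of L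
      exceeds an entry of R: otherwise such a pair would form the pattern with
      M, and conversely M can only play the 3 while an occurrence not using M
      cannot straddle L and R ([avoids231_split]).  Hence L is a word on
      {1, ..., k} and R a word on {k + 1, ..., n}, where k is the length of L
      ([perm_iota_split]).
    - M ends a run, since nothing after it is larger; it starts one only if L
      is empty.  So, for L nonempty, the starting points of L M R are those of
      L followed by those of R ([run_starts_split]), and as L lies below R the
      word is flattened iff both L and R are.  If L is empty and R is not, then
      M is a starting point larger than the next one, which is excluded.

    The words for n + 1 are therefore in bijection with the triples (k, L, R)
    with 1 <= k <= n, where L comes from a flattened 231-avoiding permutation
    of [k] and R from one of [n - k] shifted up by k.  This gives the
    convolution [card_flattened_avoidingS]; its term k = n, where R is empty,
    is the summand |F(n)| written separately in the theorem. *)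

Set Implicit Arguments.
Unset Strict Implicit.
Unset Printing Implicit Defensive.

(** * Flattened and 231-avoiding words *)

(** The starting points of the runs of a word [s] that follows the entry [p]
    and possibly continues its run, i.e. the descent bottoms of [p :: s]. *)
Fixpoint descent_bottoms (p : nat) (s : seq nat) : seq nat :=
  if s is x :: s' then
    (if x < p then [:: x] else [::]) ++ descent_bottoms x s'
  else [::].

Definition run_starts (s : seq nat) : seq nat :=
  if s is x :: s' then x :: descent_bottoms x s' else [::].

Definition flat (s : seq nat) : bool := pairwise ltn (run_starts s).

Fixpoint avoids231 (s : seq nat) : bool :=
  if s is x :: s' then
    pairwise (fun y z => ~~ (z < x < y)) s' && avoids231 s'
  else true.

Lemma descent_bottoms_cat p s1 s2 :
  descent_bottoms p (s1 ++ s2) =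
  descent_bottoms p s1 ++ descent_bottoms (last p s1) s2.
Proof. by elim: s1 p => //= x s1 IH p; rewrite IH catA. Qed.

Lemma descent_bottoms_max M s :
  all (gtn M) s -> descent_bottoms M s = run_starts s.
Proof. by case: s => //= x s /andP[-> _]. Qed.

Lemma mem_run_starts s : {subset run_starts s <= s}.
Proof.
case: s => //= x s y; rewrite !inE => /orP[-> //|yb]; apply/orP; right.
elim: s x yb => //= z s IH x; rewrite mem_cat inE => /orP[|/IH -> //].
  by case: ifP; rewrite // inE => _ ->.
by rewrite orbT.
Qed.

(** For L nonempty, M extends the run it lands in, and the first entry of R,
    being smaller than M, starts a run just as it does in R alone. *)
Lemma run_starts_split L M R :
  L != [::] -> all (gtn M) L -> all (gtn M) R ->
  run_starts (L ++ M :: R) = run_starts L ++ run_starts R.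
Proof.
case: L => //= x L _ /andP[xM LM] RM.
rewrite descent_bottoms_cat /= (descent_bottoms_max RM).
suff lastM : last x L < M by rewrite ifN // -leqNgt ltnW.
have := mem_last x L; rewrite inE => /orP[/eqP -> //|].
exact: (allP LM).
Qed.

Lemma flat_split L M R :
  L != [::] -> all (gtn M) L -> all (gtn M) R -> allrel ltn L R ->
  flat (L ++ M :: R) = flat L && flat R.
Proof.
move=> L0 LM RM /allrelP LR; rewrite /flat run_starts_split // pairwise_cat.
suff -> : allrel ltn (run_starts L) (run_starts R) by [].
by apply/allrelP => x y /mem_run_starts xL /mem_run_starts yR; apply: LR.
Qed.

Lemma flat_max_head M R : all (gtn M) R -> flat (M :: R) = nilp R.
Proof.
case: R => //= x R /andP[xM _]; rewrite /flat /= xM /= ltnNge.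
by rewrite (ltnW xM).
Qed.

(** M can play the 3 but neither the 2 nor the 1, and it plays the 3 as soon as
    some entry of L exceeds one of R.  Once L lies below R, no pattern is left
    that straddles the two parts. *)
Lemma avoids231_split L M R :
  all (gtn M) L -> all (gtn M) R ->
  avoids231 (L ++ M :: R) = [&& avoids231 L, avoids231 R & allrel leq L R].
Proof.
move=> LM RM; elim: L LM => [_|x L IH /= /andP[xM LM]] /=.
  rewrite andbT.
  suff -> : pairwise (fun y z => ~~ (z < M < y)) R by [].
  elim: R RM => //= y R IH /andP[yM RM]; rewrite IH // andbT.
  by apply/allP => z _; rewrite negb_and orbC -leqNgt ltnW.
rewrite IH // pairwise_cat /= allrel_consl.
case: (pairwise _ L); rewrite ?andbF //=.
case: (avoids231 L); rewrite ?andbF //=.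
case: (avoids231 R); rewrite ?andbF //=.
congr (_ && _).
have -> : all (fun z => ~~ (z < x < M)) R = all (leq x) R.
  by apply: eq_all => z; rewrite xM andbT -leqNgt.
case: (boolP (all (leq x) R)) => [/allP xR|]; rewrite ?andbF //=.
apply/andP; split.
  apply/allrelP => y z _; rewrite inE => /orP[/eqP -> | /xR].
    by rewrite negb_and -leqNgt ltnW.
  by rewrite leqNgt negb_and => ->.
elim: R xR {IH RM} => //= y R IH xR; rewrite IH ?andbT => [|z zR].
  apply/allP => z zR; rewrite negb_and -leqNgt xR // inE zR orbT //.
by apply: xR; rewrite inE zR orbT.
Qed.

Lemma run_starts_shift k s :
  run_starts [seq k + x | x <- s] = [seq k + x | x <- run_starts s].
Proof.
case: s => //= x s; congr cons.
by elim: s x => //= y s IH x; rewrite IH map_cat ltn_add2l; case: ifP.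
Qed.

Lemma flat_shift k s : flat [seq k + x | x <- s] = flat s.
Proof.
rewrite /flat run_starts_shift pairwise_map.
by apply: eq_pairwise => x y /=; rewrite ltn_add2l.
Qed.

Lemma avoids231_shift k s : avoids231 [seq k + x | x <- s] = avoids231 s.
Proof.
elim: s => //= x s ->; rewrite pairwise_map; congr (_ && _).
by apply: eq_pairwise => y z /=; rewrite !ltn_add2l.
Qed.

(** * Reading the properties of a permutation off its word *)

(** In a strictly increasing list, here a list of positions, coming earlier is
    the same as being smaller.  This turns list-based conditions into
    quantification over positions. *)
Lemma pairwise_ltnP (r : rel nat) s :
  pairwise ltn s -> reflect {in s &, forall i j, i < j -> r i j} (pairwise r s).
Proof.
move=> s_lt; apply: (iffP idP) => [|rs].
  elim: s s_lt => //= x s IH /andP[/allP xs /IH{}IH] /andP[/allP rx /IH{}IH].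
  move=> i j; rewrite !inE => /orP[/eqP->|iS] /orP[/eqP->|jS] //.
  - by rewrite ltnn.
  - by move=> _; apply: rx.
  - by move/(ltn_trans (xs _ iS)); rewrite ltnn.
  - exact: IH.
elim: s s_lt rs => //= x s IH /andP[/allP xs /IH{}IH] rs.
apply/andP; split; last first.
  by apply: IH => i j iS jS; apply: rs; rewrite inE ?iS ?jS orbT.
by apply/allP => y yS; apply: rs (xs _ yS); rewrite inE ?eqxx ?yS ?orbT.
Qed.

(** For i = 0 the second disjunct compares an entry with itself, so only the
    first one makes position 0 a start. *)
Definition starts_run (s : seq nat) (i : nat) : bool :=
  (i == 0) || (nth 0 s i < nth 0 s i.-1).

Lemma descent_bottoms_nth p s :
  descent_bottoms p s =
  [seq nth 0 s i | i <- iota 0 (size s) & nth 0 s i < nth 0 (p :: s) i].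
Proof.
elim: s p => //= y s IH p; rewrite IH (iotaDl 1 0) filter_map.
by case: ifP => _ /=; rewrite -map_comp.
Qed.

Lemma run_starts_nth s :
  run_starts s = [seq nth 0 s i | i <- iota 0 (size s) & starts_run s i].
Proof.
case: s => //= x s; rewrite descent_bottoms_nth (iotaDl 1 0) filter_map.
by rewrite -map_comp.
Qed.

Lemma flatP s :
  reflect (forall i j, i < j < size s -> starts_run s i -> starts_run s j ->
             nth 0 s i < nth 0 s j)
          (flat s).
Proof.
have lt_starts : pairwise ltn [seq i <- iota 0 (size s) | starts_run s i].
  by rewrite pairwise_filter // -(sorted_pairwise ltn_trans) iota_ltn_sorted.
rewrite /flat run_starts_nth pairwise_map.
apply: (iffP (pairwise_ltnP _ lt_starts)) => /= [Hs i j /andP[ij js] si sj|].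
  by apply: (Hs i j); rewrite // mem_filter mem_iota ?si ?sj ?(ltn_trans ij).
move=> Hs i j; rewrite !mem_filter !mem_iota => /andP[si _] /andP[sj js] ij.
by apply: Hs; rewrite // ij.
Qed.

Lemma avoids231P s :
  reflect (forall i j k, i < j < k -> k < size s ->
             ~~ (nth 0 s k < nth 0 s i < nth 0 s j))
          (avoids231 s).
Proof.
elim: s => [|x s IH] /=; first by constructor=> i j k.
apply: (iffP andP) => [[/(pairwiseP 0) xs /IH{}IH] [|i] [|j] [|k] //= ijk ks|H].
- by apply: xs; rewrite ?inE; lia.
- by move: ijk; rewrite ltn0 andbF.
- exact: (IH i j k ijk ks).
split; last by apply/IH => i j k; apply: (H i.+1 j.+1 k.+1).
by apply/(pairwiseP 0) => j k _ ks jk; apply: (H 0 j.+1 k.+1).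
Qed.

Section WordOfPermutation.

Variables (n : nat) (s : 'S_n).

Lemma size_word : size (word s) = n.
Proof. by rewrite size_map size_enum_ord. Qed.

Lemma nth_word (i : 'I_n) : nth 0 (word s) i = (s i).+1.
Proof. by rewrite (nth_map i) ?size_enum_ord ?ltn_ord // nth_ord_enum. Qed.

Lemma increasing_onP (i j : 'I_n) :
  reflect (forall x y : 'I_n, i <= x -> x < y -> y <= j -> s x < s y)
          (increasing_on s i j).
Proof.
apply: (iffP forallP) => [H x y ix xy yj|H x].
  by have /forallP/(_ y) := H x; rewrite ix xy yj.
by apply/forallP => y; apply/implyP => /and3P[]; apply: H.
Qed.

Lemma starts_run_descent (h i : 'I_n) :
  i = h.+1 :> nat -> starts_run (word s) i = (s i < s h).
Proof. by move=> ih; rewrite /starts_run {1}ih nth_word ih /= nth_word. Qed.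

Lemma ord_predecessor (i : 'I_n) : 0 < i -> {h : 'I_n | i = h.+1 :> nat}.
Proof.
move=> i0; have hn : i.-1 < n by apply: leq_ltn_trans (leq_pred i) (ltn_ord i).
by exists (Ordinal hn); rewrite /= prednK.
Qed.

(** A block starting at [i] that cannot be extended to the left is contained in
    a run starting at [i], namely the longest increasing block from [i]. *)
Lemma starts_run_word (i : 'I_n) :
  reflect (exists j, is_run s i j) (starts_run (word s) i).
Proof.
apply: (iffP idP) => [si|[j /and3P[ij /increasing_onP inc_ij /forallP max_ij]]].
  have inc_ii : (i <= i) && increasing_on s i i.
    by rewrite leqnn; apply/increasing_onP => x y; lia.
  (* The run is i, ..., j for the largest j with s increasing on that block. *)
  case: (@arg_maxnP _ i (fun j => (i <= j) && increasing_on s i j) val inc_ii).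
  move=> j /andP[ij inc_ij] j_max; exists j; apply/and3P; split=> //.
  apply/forallP => i'; apply/forallP => j'; apply/implyP => /and3P[i'i jj' inc].
  have ii' : i' = i.
    apply/eqP; rewrite -val_eqE eqn_leq i'i leqNgt; apply/negP => i'_lt_i.
    have [h ih] := ord_predecessor (leq_ltn_trans (leq0n _) i'_lt_i).
    move: si; rewrite (starts_run_descent ih) ltnNge => /negP; apply.
    apply/ltnW/(increasing_onP _ _ inc); first by rewrite -ltnS -ih.
      by rewrite ih.
    exact: leq_trans jj'.
  rewrite ii' eqxx /=; apply/eqP/val_inj/eqP; rewrite eqn_leq jj' andbT.
  by apply: j_max; rewrite -{2}ii' inc (leq_trans ij).
case: (posnP i) => [i0|/ord_predecessor[h ih]]; first by rewrite /starts_run i0.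
rewrite (starts_run_descent ih) ltnNge leq_eqVlt negb_or; apply/andP; split.
  by apply/negP => /eqP/val_inj/perm_inj hi; move: ih; rewrite hi; lia.
(* An ascent into i would allow extending the run to the left by h. *)
apply/negP => s_asc.
have /forallP/(_ j) := max_ij h.
suff -> : increasing_on s h j by rewrite -!val_eqE /= ih leqnn; lia.
apply/increasing_onP => x y /= ix xy yj.
have [xi|xi] := ltnP x i; last exact: inc_ij.
have xh : x = h by apply/eqP; rewrite -val_eqE eqn_leq ix -ltnS -ih xi.
rewrite {x}xh in ix xy xi *.
have [-> //|yi] := eqVneq y i.
apply: ltn_trans s_asc (inc_ij _ _ (leqnn i) _ yj).
by rewrite ltn_neqAle eq_sym (inj_eq val_inj) yi ih.
Qed.

Lemma flattened_word : flattened s = flat (word s).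
Proof.
apply/idP/flatP => [/forallP fl i j /andP[ij]|fl].
  rewrite size_word => jn.
  have i_n := ltn_trans ij jn.
  rewrite -[i]/(val (Ordinal i_n)) -[j]/(val (Ordinal jn)) !nth_word ltnS.
  move=> /starts_run_word[i' ri] /starts_run_word[j' rj].
  have /forallP/(_ i')/forallP/(_ (Ordinal jn))/forallP/(_ j') :=
    fl (Ordinal i_n).
  by rewrite ri rj ij.
apply/forallP => i; apply/forallP => i'.
apply/forallP => j; apply/forallP => j'.
apply/implyP => /and3P[ri rj ij].
rewrite -ltnS -!nth_word; apply: fl; first by rewrite ij size_word ltn_ord.
  by apply/starts_run_word; exists i'.
by apply/starts_run_word; exists j'.
Qed.

Lemma avoids_word : avoids s p231 = avoids231 (word s).
Proof.
apply/idP/avoids231P => [av i j k /andP[ij jk]|av].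
  rewrite size_word => kn.
  have jn := ltn_trans jk kn; have i_n := ltn_trans ij jn.
  rewrite -[i]/(val (Ordinal i_n)) -[j]/(val (Ordinal jn)).
  rewrite -[k]/(val (Ordinal kn)) !nth_word !ltnS.
  apply: contra av => /andP[ki kj]; apply/existsP.
  exists [ffun a : 'I_3 => nth (Ordinal i_n)
            [:: Ordinal i_n; Ordinal jn; Ordinal kn] a].
  apply/andP; split; apply/forallP => a; apply/forallP => b; rewrite !ffunE.
    by case: a b => [[|[|[|]]] //= _] [[|[|[|]]] //= _]; lia.
  rewrite !permE.
  by case: a b => [[|[|[|]]] //= _] [[|[|[|]]] //= _]; apply/eqP; lia.
apply/existsP => -[f /andP[/forallP f_mono /forallP f_iso]].
pose a0 : 'I_3 := inord 0; pose a1 : 'I_3 := inord 1; pose a2 : 'I_3 := inord 2.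
have /forallP/(_ a1) := f_mono a0; have /forallP/(_ a2) := f_mono a1.
have /forallP/(_ a0) := f_iso a2; have /forallP/(_ a1) := f_iso a0.
rewrite !permE /= !inordK //= => /eqP s01 /eqP s20 f12 f01.
have := av (f a0) (f a1) (f a2).
by rewrite f01 f12 size_word ltn_ord !nth_word !ltnS s01 s20 => /(_ isT isT).
Qed.

Lemma perm_word : perm_eq (word s) (iota 1 n).
Proof.
have -> : word s = [seq (val i).+1 | i <- [seq s i | i <- enum 'I_n]].
  by rewrite -map_comp.
rewrite (iotaDl 1 0) -val_enum_ord -map_comp perm_map //.
apply: uniq_perm; rewrite ?(map_inj_uniq (@perm_inj _ s)) ?enum_uniq // => i.
by rewrite -[i](permKV s) mem_map ?mem_enum //; apply: perm_inj.
Qed.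

End WordOfPermutation.

Lemma word_inj n : injective (@word n).
Proof.
move=> s t st; apply/permP => i; apply/val_inj/succn_inj.
by rewrite -!nth_word st.
Qed.

Lemma word_surj n w : perm_eq w (iota 1 n) -> exists s : 'S_n, word s = w.
Proof.
move=> w_perm.
have w_size : size w = n by rewrite (perm_size w_perm) size_iota.
have w_uniq : uniq w by rewrite (perm_uniq w_perm) iota_uniq.
have w_range (i : 'I_n) : 0 < nth 0 w i <= n.
  have : nth 0 w i \in iota 1 n.
    by rewrite -(perm_mem w_perm) mem_nth // w_size ltn_ord.
  by rewrite mem_iota; lia.
have w_pred (i : 'I_n) : (nth 0 w i).-1 < n by have := w_range i; lia.
have f_inj : injective (fun i => Ordinal (w_pred i)).
  move=> i j /(congr1 val) /= wij; apply/val_inj/eqP.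
  rewrite -(nth_uniq 0 _ _ w_uniq) ?w_size ?ltn_ord //.
  have /andP[wi _] := w_range i; have /andP[wj _] := w_range j.
  by rewrite -(prednK wi) -(prednK wj) wij.
exists (perm f_inj).
apply: (@eq_from_nth _ 0) => [|i]; rewrite size_word // => i_n.
rewrite -[i]/(val (Ordinal i_n)) nth_word permE /= prednK //.
by have /andP[] := w_range (Ordinal i_n).
Qed.

(** * Decomposition around the largest entry *)

(** Lists of naturals rather than permutations: pieces of a word can be cut out,
    shifted and concatenated without changing type with the length. *)
Definition fwords n : seq (seq nat) := [seq word s | s in 'F(n; p231)].

Lemma size_fwords n : size (fwords n) = #|'F(n; p231)|.
Proof. exact: size_image. Qed.

Lemma fwords_uniq n : uniq (fwords n).
Proof. by rewrite map_inj_uniq ?enum_uniq //; apply: word_inj. Qed.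

Lemma mem_fwords n w :
  (w \in fwords n) = [&& perm_eq w (iota 1 n), flat w & avoids231 w].
Proof.
apply/imageP/and3P => [[s]|[/word_surj[s <-] fl av]].
  rewrite inE flattened_word avoids_word => /andP[fl av] ->.
  by rewrite perm_word.
by exists s; rewrite // inE flattened_word avoids_word fl av.
Qed.

(** Sorting L and R separately already sorts L ++ R, because L lies below R;
    the sorted list is the interval, which is then cut after [size L]. *)
Lemma perm_iota_split m L R :
  allrel leq L R -> perm_eq (L ++ R) (iota m (size L + size R)) ->
  perm_eq L (iota m (size L)) && perm_eq R (iota (m + size L) (size R)).
Proof.
move=> LR LR_perm.
have : sort leq L ++ sort leq R = iota m (size L + size R).
  apply: (sorted_eq leq_trans anti_leq); last first.
  - rewrite -(permPr LR_perm); apply: perm_cat; exact/permPl/perm_sort.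
  - exact: iota_sorted.
  rewrite (sorted_pairwise leq_trans) pairwise_cat.
  rewrite -!(sorted_pairwise leq_trans) !(sort_sorted leq_total) !andbT.
  by apply/allrelP => x y; rewrite !mem_sort; apply: (allrelP LR).
rewrite iotaD => /eqP; rewrite eqseq_cat ?size_sort ?size_iota //.
case/andP=> /eqP <- /eqP <-.
by rewrite !(perm_sym _ (sort _ _)) !perm_sort !perm_refl.
Qed.

(** The inverse of cutting at n + 1.  R is stored as a word on {1, ..., n - k},
    hence the shift by [k]. *)
Definition join_max n (k : nat) (p : seq nat * seq nat) : seq nat :=
  p.1 ++ n.+1 :: [seq k + x | x <- p.2].

Lemma perm_insert_max n L R :
  perm_eq (L ++ n.+1 :: R) (iota 1 n.+1) = perm_eq (L ++ R) (iota 1 n).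
Proof.
have -> : iota 1 n.+1 = iota 1 n ++ [:: n.+1]
  by have := iotaD 1 n 1; rewrite addn1.
by rewrite -cat1s perm_catCA perm_sym perm_catC perm_sym perm_cat2l.
Qed.

Lemma mem_join_max n k L R :
  0 < k <= n -> perm_eq L (iota 1 k) -> perm_eq R (iota 1 (n - k)) ->
  (join_max n k (L, R) \in fwords n.+1) =
  (L \in fwords k) && (R \in fwords (n - k)).
Proof.
move=> /andP[k_gt0 kn] Lk Rk.
have Ls : size L = k by rewrite (perm_size Lk) size_iota.
have Rs : perm_eq [seq k + x | x <- R] (iota k.+1 (n - k)).
  by rewrite -addn1 iotaDl perm_map.
have LM : all (gtn n.+1) L.
  by apply/allP => x; rewrite (perm_mem Lk) mem_iota /=; lia.
have RM : all (gtn n.+1) [seq k + x | x <- R].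
  by apply/allP => x; rewrite (perm_mem Rs) mem_iota /=; lia.
have LR : allrel ltn L [seq k + x | x <- R].
  apply/allrelP => x y; rewrite (perm_mem Lk) (perm_mem Rs) !mem_iota; lia.
have L0 : L != [::] by rewrite -size_eq0 Ls -lt0n.
rewrite !mem_fwords Lk Rk /join_max /= flat_split // avoids231_split //.
rewrite flat_shift avoids231_shift.
have -> : allrel leq L [seq k + x | x <- R].
  by apply/allrelP => x y xL yR; apply/ltnW/(allrelP LR).
have -> : perm_eq (L ++ n.+1 :: [seq k + x | x <- R]) (iota 1 n.+1).
  rewrite perm_insert_max -(subnKC kn) iotaD; exact: perm_cat.
by rewrite andbT /= -!andbA; bool_congr; rewrite andbCA.
Qed.

(** Cutting a word at its largest entry n + 1.  As n > 0, the left part is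
    nonempty: otherwise n + 1 would start the first of several runs. *)
Lemma mem_fwordsS n w : 0 < n ->
  reflect (exists k p, [/\ k \in iota 1 n,
             p \in [seq (L, R) | L <- fwords k, R <- fwords (n - k)]
             & w = join_max n k p])
          (w \in fwords n.+1).
Proof.
move=> n_gt0; apply: (iffP idP) => [w_in|[k [p [+ + ->]]]]; last first.
  rewrite mem_iota => kn /allpairsP[[L R] /= [LF RF ->]].
  have := LF; rewrite mem_fwords => /and3P[Lk _ _].
  have := RF; rewrite mem_fwords => /and3P[Rk _ _].
  by rewrite mem_join_max ?LF ?RF.
have := w_in; rewrite mem_fwords => /and3P[w_perm fl av].
have Mw : n.+1 \in w by rewrite (perm_mem w_perm) mem_iota leqnn.
case/splitPr: Mw w_in w_perm fl av => L R w_in w_perm fl av.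
have LR_perm : perm_eq (L ++ R) (iota 1 n) by rewrite -perm_insert_max.
have LR_size : size L + size R = n.
  by rewrite -size_cat (perm_size LR_perm) size_iota.
have /andP[LM RM] : all (gtn n.+1) L && all (gtn n.+1) R.
  rewrite -all_cat; apply/allP => x.
  by rewrite (perm_mem LR_perm) mem_iota => /andP[].
have L_gt0 : 0 < size L.
  rewrite lt0n size_eq0; apply/negP => /eqP L0; move: fl LR_size n_gt0.
  by rewrite L0 flat_max_head // => /nilP -> <-.
have := av; rewrite avoids231_split // => /and3P[_ _ LR].
have := LR_perm; rewrite -{1}LR_size => /(perm_iota_split LR)/andP[Lk Rk].
pose k := size L; pose R' := [seq x - k | x <- R].
have kn : 0 < k <= n by rewrite L_gt0 -LR_size leq_addr.
have nk : n - k = size R by rewrite -LR_size addKn.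
have R_shift : R = [seq k + x | x <- R'].
  rewrite -map_comp map_id_in // => x.
  by rewrite (perm_mem Rk) mem_iota /= => /andP[kx _]; rewrite subnKC // ltnW.
have R'k : perm_eq R' (iota 1 (n - k)).
  by apply: (perm_map_inj (@addnI k)); rewrite -R_shift -iotaDl addnC nk.
have := w_in; rewrite R_shift -/(join_max n k (L, R')).
rewrite mem_join_max // => /andP[LF RF].
exists k, (L, R'); split=> //; first by rewrite mem_iota add1n ltnS.
by apply/allpairsP; exists (L, R').
Qed.

Lemma card_flattened_avoidingS n : 0 < n ->
  #|'F(n.+1; p231)| =
  \sum_(1 <= k < n.+1) #|'F(k; p231)| * #|'F(n - k; p231)|.
Proof.
move=> n_gt0; rewrite -size_fwords.
pose ps k := [seq (L, R) | L <- fwords k, R <- fwords (n - k)].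
have -> : size (fwords n.+1) =
          size [seq join_max n k p | k <- iota 1 n, p <- ps k].
  apply/perm_size/uniq_perm; first exact: fwords_uniq; last first.
    by move=> w; apply/mem_fwordsS/allpairsPdep.
  apply: allpairs_uniq_dep; first exact: iota_uniq.
    move=> k _; apply: allpairs_uniq; try exact: fwords_uniq.
    by move=> [? ?] [? ?] _ _ [-> ->].
  (* The parameters can be read off the word: k is the position of n + 1. *)
  have join_max_size k p : k \in iota 1 n -> p \in ps k ->
      index n.+1 (join_max n k p) = k /\ size p.1 = k.
    move=> kn /allpairsP[[L R] /= [+ _ ->]].
    rewrite mem_fwords => /and3P[Lk _ _].
    have Ls : size L = k by rewrite (perm_size Lk) size_iota.
    split=> //; rewrite /join_max index_cat /= eqxx addn0 Ls (perm_mem Lk).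
    move: kn; rewrite !mem_iota; case: ifP => //; lia.
  move=> u u' /allpairsPdep[k [p [kn pk ->]]] {u}.
  move=> /allpairsPdep[k' [p' [kn' pk' ->]]] {u'}.
  rewrite /= => e.
  have [ik sk] := join_max_size _ _ kn pk.
  have [ik' sk'] := join_max_size _ _ kn' pk'.
  have kk' : k = k' by rewrite -ik e.
  move: sk' e; rewrite -{k' kn' pk' ik'}kk' => sk' /eqP.
  rewrite /join_max eqseq_cat ?sk // eqseq_cons.
  case/and3P=> /eqP e1 _ /eqP e2'.
  have e2 := inj_map (@addnI k) e2'.
  by case: p p' e1 e2 {pk ik sk sk' e2'} => [L R] [L' R'] /= -> ->.
rewrite size_allpairs_dep sumnE big_map /index_iota subn1 /=.
by apply: eq_bigr => k _; rewrite size_allpairs !size_fwords.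
Qed.

Lemma card_flattened_avoiding0 : #|'F(0; p231)| = 1.
Proof.
rewrite -size_fwords; apply/(perm_size (s2 := [:: [::]]))/uniq_perm => //.
  exact: fwords_uniq.
move=> w; rewrite mem_fwords inE; case: w => [|x w] //.
by rewrite -size_eq0; apply/negP => /andP[/perm_size].
Qed.

Lemma card_flattened_avoiding1 : #|'F(1; p231)| = 1.
Proof.
rewrite -size_fwords; apply/(perm_size (s2 := [:: [:: 1]]))/uniq_perm => //.
  exact: fwords_uniq.
move=> w; rewrite mem_fwords inE; apply/and3P/eqP => [[w1 _ _]|-> //].
by apply: perm_small_eq w1.
Qed.

Theorem theorem2p16 :
  [/\ #|'F(1; p231)| = 1,
      #|'F(2; p231)| = 1
    & forall n : nat, 3 <= n ->
        #|'F(n; p231)| =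
          #|'F(n - 1; p231)| +
          \sum_(2 <= k < n) #|'F(k - 1; p231)| * #|'F(n - k; p231)|].
Proof.
split; first exact: card_flattened_avoiding1.
  rewrite card_flattened_avoidingS // big_nat1 card_flattened_avoiding1.
  by rewrite card_flattened_avoiding0.
case=> // n n_gt1; rewrite card_flattened_avoidingS; last by lia.
rewrite big_nat_recr /=; last by lia.
rewrite subnn card_flattened_avoiding0 muln1 subn1 addnC; congr (_ + _).
by rewrite [RHS]big_add1 /=; apply: eq_bigr => k _; rewrite subn1.
Qed.
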